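(* Let $c_1,c_2>0$ and let $H_1,H_2\in C^\infty(\mathbb T^n\times\mathbb R^n)$. Assume that there exist $\omega_1,\omega_2>0$ such that for $j=1,2$ $$\lim_{|p|\to+\infty}\left[\omega_j|H_j(x,p)|^2+D_xH_j(x,p)\cdot p-16n\,\omega_jc_j^2|p|^2\right]=+\infty\quad\text{uniformly in }x\in\mathbb T^n.$$ For $\varepsilon>0$ let $(u_1^\varepsilon,u_2^\varepsilon)$ be the unique pair of smooth solutions of $$\begin{cases}(c_1+\varepsilon)u_1^\varepsilon-c_1u_2^\varepsilon+H_1(x,Du_1^\varepsilon)=\varepsilon^2\Delta u_1^\varepsilon\\(c_2+\varepsilon)u_2^\varepsilon-c_2u_1^\varepsilon+H_2(x,Du_2^\varepsilon)=\varepsilon^2\Delta u_2^\varepsilon\end{cases}\quad\text{in }\mathbb T^n,$$ and let $\overline H$ be the effective Hamiltonian defined in the context. Then there exist $\varepsilon_0>0$ and a constant $C>0$, independent of $\varepsilon$, such that for all $\varepsilon\in(0,\varepsilon_0)$ $$\|\varepsilon u_i^\varepsilon+\overline H\|_{L^\infty}\le C\varepsilon,\qquad i=1,2.$$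
   Context: $\mathbb T^n=\mathbb R^n/\mathbb Z^n$, $n\ge2$. The effective Hamiltonian $\overline H$ is the unique real constant such that the system $$\begin{cases}c_1u_1-c_1u_2+H_1(x,Du_1)=\overline H\\-c_2u_1+c_2u_2+H_2(x,Du_2)=\overline H\end{cases}\quad\text{in }\mathbb T^n$$ admits a viscosity solution $(u_1,u_2)\in C(\mathbb T^n)^2$ (each component being a viscosity solution of its equation with the other component regarded as a given continuous function). Its existence and uniqueness is part of the setting. *)

(* Defs.v *)
From HB Require Import structures.
From mathcomp Require Import all_boot all_order all_algebra.
From mathcomp Require Import all_classical all_reals all_analysis.

Set Implicit Arguments.
Unset Strict Implicit.
Unset Printing Implicit Defensive.

Import Order.TTheory GRing.Theory Num.Theory.
Import numFieldNormedType.Exports.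

Local Open Scope classical_set_scope.
Local Open Scope ring_scope.

(* The norm that the library puts on ['rV[R]_n] is the max norm; the Euclidean
   structure is therefore introduced explicitly. *)
Definition dot {R : realType} {n : nat} (p q : 'rV[R]_n) : R :=
  \sum_(i < n) p 0 i * q 0 i.

Definition enorm {R : realType} {n : nat} (p : 'rV[R]_n) : R :=
  Num.sqrt (dot p p).

Definition basis_vec {R : realType} {n : nat} (i : 'I_n) : 'rV[R]_n :=
  delta_mx 0 i.

Definition grad {R : realType} {n : nat} (f : 'rV[R]_n -> R) (x : 'rV[R]_n) :
    'rV[R]_n :=
  \row_(i < n) 'D_(basis_vec i) f x.

Definition laplacian {R : realType} {n : nat} (f : 'rV[R]_n -> R)
    (x : 'rV[R]_n) : R :=
  \sum_(i < n) 'D_(basis_vec i) ('D_(basis_vec i) f) x.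

(* Only used for finite-dimensional [V], where continuity of [x |-> 'D_v f x]
   for each fixed [v] amounts to continuity of the differential. *)
Fixpoint Ck {R : realType} {V : normedModType R} (k : nat) (f : V -> R) : Prop :=
  match k with
  | 0%N => continuous f
  | k'.+1 => (forall x, differentiable f x) /\ (forall v, Ck k' ('D_v f))
  end.

Definition smooth {R : realType} {V : normedModType R} (f : V -> R) : Prop :=
  forall k, Ck k f.

(* Functions on the torus R^n / Z^n are represented by their Z^n-periodic lifts
   to R^n. *)
Definition torus_fun {R : realType} {n : nat} (f : 'rV[R]_n -> R) : Prop :=
  forall i : 'I_n, periodic f (basis_vec i).

Definition smooth_hamiltonian {R : realType} {n : nat}
    (H : 'rV[R]_n -> 'rV[R]_n -> R) : Prop :=
  (forall p, torus_fun (H^~ p)) /\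
  smooth (fun z : 'rV[R]_n * 'rV[R]_n => H z.1 z.2).

Definition growth_condition {R : realType} {n : nat}
    (H : 'rV[R]_n -> 'rV[R]_n -> R) (c omega : R) : Prop :=
  forall M : R, exists K : R, forall x p : 'rV[R]_n, K < enorm p ->
    M < omega * `|H x p| ^+ 2 + dot (grad (H^~ p) x) p
        - 16 * n%:R * omega * c ^+ 2 * enorm p ^+ 2.

(* Viscosity solutions of the scalar equation F(x, u, Du) = 0. Touching is a
   local notion, so the test functions need not be periodic. *)
Definition viscosity_subsolution {R : realType} {n : nat}
    (F : 'rV[R]_n -> R -> 'rV[R]_n -> R) (u : 'rV[R]_n -> R) : Prop :=
  forall (phi : 'rV[R]_n -> R) (x0 : 'rV[R]_n), Ck 1 phi ->
    (\forall x \near x0, u x - phi x <= u x0 - phi x0) ->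
    F x0 (u x0) (grad phi x0) <= 0.

Definition viscosity_supersolution {R : realType} {n : nat}
    (F : 'rV[R]_n -> R -> 'rV[R]_n -> R) (u : 'rV[R]_n -> R) : Prop :=
  forall (phi : 'rV[R]_n -> R) (x0 : 'rV[R]_n), Ck 1 phi ->
    (\forall x \near x0, u x0 - phi x0 <= u x - phi x) ->
    0 <= F x0 (u x0) (grad phi x0).

Definition viscosity_solution {R : realType} {n : nat}
    (F : 'rV[R]_n -> R -> 'rV[R]_n -> R) (u : 'rV[R]_n -> R) : Prop :=
  viscosity_subsolution F u /\ viscosity_supersolution F u.

Definition cell_problem_solution {R : realType} {n : nat} (c1 c2 : R)
    (H1 H2 : 'rV[R]_n -> 'rV[R]_n -> R) (h : R) (u1 u2 : 'rV[R]_n -> R) : Prop :=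
  [/\ torus_fun u1 /\ continuous u1,
      torus_fun u2 /\ continuous u2,
      viscosity_solution
        (fun x r p => c1 * r - c1 * u2 x + H1 x p - h) u1 &
      viscosity_solution
        (fun x r p => - c2 * u1 x + c2 * r + H2 x p - h) u2].

Definition effective_hamiltonian {R : realType} {n : nat} (c1 c2 : R)
    (H1 H2 : 'rV[R]_n -> 'rV[R]_n -> R) (Hbar : R) : Prop :=
  unique (fun h => exists u1 u2, cell_problem_solution c1 c2 H1 H2 h u1 u2) Hbar.

Definition regularized_solution {R : realType} {n : nat} (c1 c2 : R)
    (H1 H2 : 'rV[R]_n -> 'rV[R]_n -> R) (eps : R) (u1 u2 : 'rV[R]_n -> R) : Prop :=
  [/\ torus_fun u1 /\ smooth u1,
      torus_fun u2 /\ smooth u2,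
      forall x, (c1 + eps) * u1 x - c1 * u2 x + H1 x (grad u1 x)
                = eps ^+ 2 * laplacian u1 x &
      forall x, (c2 + eps) * u2 x - c2 * u1 x + H2 x (grad u2 x)
                = eps ^+ 2 * laplacian u2 x].

(* Only used for continuous functions, for which the essential supremum is the
   supremum; taken in the extended reals so that it is meaningful without a
   boundedness assumption. *)
Definition sup_norm {R : realType} {n : nat} (f : 'rV[R]_n -> R) : \bar R :=
  ereal_sup [set `|f x|%:E | x in [set: 'rV[R]_n]].

(* Main.v *)
Require Import Defs.
From HB Require Import structures.
From mathcomp Require Import all_boot all_order all_algebra.
From mathcomp Require Import all_classical all_reals all_analysis.
From mathcomp Require Import ring lra.

Set Implicit Arguments.
Unset Strict Implicit.
Unset Printing Implicit Defensive.

Import Order.TTheory GRing.Theory Num.Theory.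
Import numFieldNormedType.Exports.

Local Open Scope classical_set_scope.
Local Open Scope ring_scope.

(** The theorem holds because doubling the variables at scale [eps] compares the
viscous solution [U] of the regularized system with a solution [u] of the
cell problem, and every error term is of order [eps]; the periodic solution [u]
is one of those that the effective Hamiltonian provides.

Maximize [U_i x - u_i y - |x - y|^2 / (2 eps)] over both the components [i]
and the points [x], [y] ([doubling_max]), and put [p = (x - y) / eps].  At the
maximum [grad U_i x = p] and [laplacian U_i x <= n / eps]
([touch_above_grad_laplacian]), so the viscous term [eps^2 laplacian U_i x] is
at most [n eps]; the supersolution property of [u_i] at [y] holds with the
same [p].  Since [i] maximizes as well, [U_i x - U_j x >= u_i y - u_j y] for
the other component [j], so the coupling terms can be dropped when the two
equations are subtracted, and what is left is
  [eps U_i x + Hbar <= n eps + (H_i y p - H_i x p)].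

It remains to bound the difference of Hamiltonians by a multiple of [eps],
without any a priori bound on [p].  This is [hamiltonian_quasi_monotone], and
it is where the growth condition enters.  Along the segment from [y] to [x],
which has direction [p], the derivative of [t |-> H_i (y + t p) p] is
[D_x H_i . p].  The equations bound [H_i y p] from below and [H_i x p] from
above.  If [|p|] is large, the growth condition makes this derivative positive
wherever the function takes moderate values, so the function cannot cross a
moderate level downwards and the difference is nonpositive
([no_down_crossing]); if [|p|] is bounded, the mean value theorem and
compactness give a bound [L eps].  No gradient estimate on [U] or [u] is
involved.

The bound from below is the same argument for [u_i x - U_i y].  Both are run
at once with a sign [sg], maximizing [sg U_i x - sg u_i y - ...]
([one_sided_rate]).  The two components are indexed by [bool], so that [~~ i]
is the other component. *)

(** * One-variable calculus *)

Lemma derive_gt0_right (R : realType) (f : R -> R) (x l : R) :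
  is_derive x 1 f l -> 0 < l ->
  exists2 d, 0 < d & forall h, 0 < h < d -> f x < f (x + h).
Proof.
move=> [df <-] l0.
have : \forall h \near 0^', 0 < h^-1 *: ((f \o shift x) (h *: 1) - f x).
  by apply: (cvgr_gt _ df).
rewrite near_withinE => -[d /= d0 Hd]; exists d => // h /andP[h0 hd].
have := Hd h; rewrite /= sub0r normrN gtr0_norm // => /(_ hd (lt0r_neq0 h0)).
by rewrite !scaler1 /GRing.scale /= pmulr_rgt0 ?invr_gt0 // subr_gt0 addrC.
Qed.

(** Both sides are limits of the same difference quotient, so this transfers
facts in both directions between directional and one-variable derivatives. *)
Lemma is_derive_line (R : realType) (V : normedModType R) (f : V -> R)
    (x v : V) (t l : R) :
  is_derive t 1 (fun s => f (x + s *: v)) l <-> is_derive (x + t *: v) v f l.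
Proof.
have E : (fun h : R => h^-1 *: (((fun s => f (x + s *: v)) \o shift t) (h *: 1)
            - f (x + t *: v)))
  = (fun h => h^-1 *: ((f \o shift (x + t *: v)) (h *: v) - f (x + t *: v))).
  apply: funext => h /=; congr (_ *: (f _ - _)).
  by rewrite scaler1 scalerDl addrCA.
split=> -[].
  by rewrite /derivable /derive E => d1 d2; split.
by rewrite /derivable /derive -E => d1 d2; split.
Qed.

(** At the last point of [[a, b]] where [f] is above an intermediate level that
lies in the range where the derivative is known, [f] would be increasing and
could not drop below that level immediately afterwards. *)
Lemma no_down_crossing (R : realType) (f df : R -> R) (a b C : R) :
  (forall t : R, is_derive t 1 f (df t)) ->
  (forall t, a <= t <= b -> `|f t| < C -> 0 < df t) ->
  0 < C -> a <= b -> - C < f a -> f b < C -> f a <= f b.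
Proof.
move=> fd fpos C0 ab fa fb; rewrite leNgt; apply/negP => fba.
have cf : continuous f.
  move=> t; apply: differentiable_continuous; apply/derivable1_diffP.
  by have [] := fd t.
have [l /andP[lb la] lC] : exists2 l, f b < l < f a & `|l| < C.
  exists ((Num.max (f b) (- C) + Num.min (f a) C) / 2).
    by case: (leP (f b) (- C)) => ?; case: (leP (f a) C) => ?; lra.
  by rewrite ltr_norml; case: (leP (f b) (- C)) => ?; case: (leP (f a) C) => ?; lra.
(* [c] is the last point of the segment where [f] is at least [l]. *)
pose S := `[a, b]%classic `&` f @^-1` [set y | l <= y].
have cS : compact S.
  apply: compact_closedI; first exact: segment_compact.
  by apply: closed_comp => [? _|]; [exact: cf | exact: closed_ge].
have Sa : S a by split; rewrite /= ?in_itv /= ?lexx ?ab // ltW.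
have [c /set_mem[+ lc] cmax] : exists2 c : R, c \in S & forall t : R, t \in S -> t <= c.
  apply: (@compact_EVT_max _ _ id) => //; first by exists a.
  by apply: continuous_subspaceT => ?; exact: cvg_id.
rewrite /= in_itv /= => /andP[ac cb].
have {}cmax t : c < t -> t <= b -> f t < l.
  move=> ct tb; rewrite ltNge; apply/negP => lt.
  have : t <= c by apply: cmax; apply/mem_set; split=> //=; rewrite in_itv /=; lra.
  by lra.
have {}cb : c < b.
  by rewrite lt_neqAle cb andbT; apply: contraTneq lb => <-; rewrite -leNgt.
have {lc} fc : f c = l.
  apply/eqP; rewrite eq_le lc andbT leNgt; apply/negP => lfc.
  have [|||t /[!in_itv]/= /andP[ct tb] ft] := @IVT _ f c b l.
  - exact: ltW.
  - exact: continuous_subspaceT.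
  - by rewrite ge_min le_max (ltW lb) (ltW lfc) orbT.
  - move: ct; rewrite le_eqVlt => /orP[/eqP ect|ct]; first by rewrite ect ft ltxx in lfc.
    by have := cmax t ct tb; rewrite ft ltxx.
have dc : 0 < df c by apply: fpos; [rewrite ac ltW | rewrite fc].
have [d d0 Hd] := derive_gt0_right (fd c) dc.
pose h := Num.min (d / 2) (b - c).
have h0 : 0 < h by rewrite lt_min subr_gt0 cb divr_gt0.
have hd : h < d by rewrite gt_min; apply/orP; left; lra.
have hb : c + h <= b by rewrite -lerBrDl ge_min lexx orbT.
have := Hd h; rewrite h0 hd => /(_ isT).
have := cmax (c + h) _ hb; rewrite ltrDl => /(_ h0); rewrite fc; lra.
Qed.

(** After subtracting the parabola, the difference [h] has a maximum at 0, hence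
a critical point; if its second derivative were positive, its derivative would
be positive right of 0 and [h] would exceed its maximum. *)
Lemma touch_above_derivatives (R : realType) (g g1 : R -> R) (g2 q s : R) :
  (forall t : R, is_derive t 1 g (g1 t)) -> is_derive (0 : R) 1 g1 g2 ->
  (forall t, g t <= g 0 + t * q + t ^+ 2 * (s / 2)) ->
  g1 0 = q /\ g2 <= s.
Proof.
move=> gd g1d gle.
pose h t := g t - (t * q + t ^+ 2 * (s / 2)).
pose h1 t := g1 t - (q + t * s).
have hd (t : R) : is_derive t 1 h (h1 t).
  rewrite /h; apply: is_derive_eq; rewrite /h1 /GRing.scale /=; lra.
have h1d : is_derive (0 : R) 1 h1 (g2 - s).
  by rewrite /h1; apply: is_derive_eq; rewrite /GRing.scale /=; lra.
have hmax t : h t <= h 0 by have := gle t; rewrite /h; lra.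
have h10 : h1 0 = 0.
  have [||||_ E] := @derive1_at_max _ h (- 1) 1 0.
  - lra.
  - by move=> t _; have [] := hd t.
  - by rewrite in_itv /=; lra.
  - by [].
  - by have [_ <-] := hd 0.
have g10 : g1 0 = q by move: h10; rewrite /h1; lra.
split=> //; rewrite leNgt; apply/negP => sg.
have [|d d0 Hd] := derive_gt0_right h1d; first by lra.
have [||c] := @MVT _ h h1 0 (d / 2).
- by lra.
- apply: derivable_within_continuous => t _; by have [] := hd t.
rewrite in_itv /= => /andP[c0 cd] E.
have h1c : 0 < h1 c by have := Hd c; rewrite add0r h10; apply; lra.
have : 0 < h1 c * (d / 2 - 0) by apply: mulr_gt0 => //; lra.
by have := hmax (d / 2); lra.
Qed.

(** * The Euclidean product, quadratic penalties and touching *)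

Section dot_theory.
Variables (R : realType) (n : nat).
Implicit Types p q x y : 'rV[R]_n.

Lemma dotC p q : dot p q = dot q p.
Proof. by apply: eq_bigr => i _; rewrite mulrC. Qed.

Lemma dotDl p q r : dot (p + q) r = dot p r + dot q r.
Proof. by rewrite -big_split; apply: eq_bigr => i _; rewrite !mxE mulrDl. Qed.

Lemma dotZl a p q : dot (a *: p) q = a * dot p q.
Proof. by rewrite /dot mulr_sumr; apply: eq_bigr => i _; rewrite !mxE mulrA. Qed.

Lemma dotDr p q r : dot r (p + q) = dot r p + dot r q.
Proof. by rewrite dotC dotDl !(dotC r). Qed.

Lemma dotZr a p q : dot p (a *: q) = a * dot p q.
Proof. by rewrite dotC dotZl dotC. Qed.

Lemma dot_basis i p : dot (basis_vec i) p = p 0 i.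
Proof.
rewrite /dot (bigD1 i) //= big1 => [|j ji]; rewrite !mxE ?eqxx ?mul1r ?addr0 //.
by rewrite (negbTE ji) mul0r.
Qed.

Lemma dot_ge0 p : 0 <= dot p p.
Proof. by apply: sumr_ge0 => i _; exact: sqr_ge0. Qed.

Lemma sqr_enorm p : enorm p ^+ 2 = dot p p.
Proof. by rewrite sqr_sqrtr ?dot_ge0. Qed.

Lemma sqr_coord_le_dot p i : p 0 i ^+ 2 <= dot p p.
Proof.
rewrite /dot (bigD1 i) //= expr2 lerDl.
by apply: sumr_ge0 => j _; exact: sqr_ge0.
Qed.

Lemma norm_le_enorm p : `|p| <= enorm p.
Proof.
change (mx_norm p <= enorm p).
rewrite mx_normrE; apply: bigmax_le => [|[i j] _ /=]; first exact: sqrtr_ge0.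
rewrite ord1 -ler_sqr ?nnegrE ?sqrtr_ge0 // !real_normK ?num_real // sqr_enorm.
exact: sqr_coord_le_dot.
Qed.

Lemma sqr_norm_le_dot p : `|p| ^+ 2 <= dot p p.
Proof.
by rewrite -sqr_enorm ler_sqr ?nnegrE ?norm_le_enorm ?sqrtr_ge0.
Qed.

Lemma coord_le_norm p i : `|p 0 i| <= `|p|.
Proof.
change (`|p 0 i| <= mx_norm p); rewrite mx_normrE.
exact: (le_bigmax _ (fun k : 'I_1 * 'I_n => `|p k.1 k.2|) (0, i)).
Qed.

Lemma derive_dot_grad (f : 'rV[R]_n -> R) x v :
  differentiable f x -> 'D_v f x = dot v (grad f x).
Proof.
move=> df; rewrite deriveE // {1}(row_sum_delta v) linear_sum /dot.
by apply: eq_bigr => i _; rewrite linearZ /= mxE deriveE.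
Qed.

Lemma differentiable_dot (V : normedModType R) (f g : V -> 'rV[R]_n) (t : V) :
  differentiable f t -> differentiable g t ->
  differentiable (fun w => dot (f w) (g w)) t.
Proof.
move=> df dg; rewrite /dot.
have -> : (fun w => \sum_(i < n) f w 0 i * g w 0 i) =
    \sum_(i < n) ((fun w => f w 0 i) * (fun w => g w 0 i)).
  by apply: funext => w; rewrite fct_sumE.
apply: differentiable_sum => i; apply: differentiableM.
  exact: (differentiable_comp df (differentiable_coord _ _ _)).
exact: (differentiable_comp dg (differentiable_coord _ _ _)).
Qed.

(** The penalty of the doubling argument, which is also the test function for
the viscosity inequalities. *)
Definition sqdist a (z y : 'rV[R]_n) : R := a * dot (y - z) (y - z).

Lemma sqdistC a x y : sqdist a x y = sqdist a y x.
Proof.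
by rewrite /sqdist -(opprB x y) -scaleN1r dotZl dotZr !mulN1r opprK.
Qed.

Lemma sqdist_translate a x y k : sqdist a (x + k) (y + k) = sqdist a x y.
Proof. by rewrite /sqdist opprD addrACA subrr addr0. Qed.

Lemma sqdist_same a x : sqdist a x x = 0.
Proof. by rewrite /sqdist subrr /dot big1 ?mulr0 // => i _; rewrite mxE mul0r. Qed.

Lemma sqdistD a (x z w : 'rV[R]_n) :
  sqdist a z (x + w) = sqdist a z x + 2 * a * dot w (x - z) + a * dot w w.
Proof.
rewrite /sqdist addrAC; move: (x - z) => y.
by rewrite !(dotDl, dotDr) (dotC y w); ring.
Qed.

Lemma sqdist_is_derive a z v x :
  is_derive x v (sqdist a z) (2 * a * dot v (x - z)).
Proof.
suff : is_derive (x + 0 *: v) v (sqdist a z) (2 * a * dot v (x - z)).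
  by rewrite scale0r addr0.
apply/is_derive_line.
have -> : (fun s : R => sqdist a z (x + s *: v)) =
    (fun s => sqdist a z x + s * (2 * a * dot v (x - z))
              + s ^+ 2 * (a * dot v v)).
  by apply: funext => s; rewrite sqdistD !(dotZl, dotZr); ring.
by apply: is_derive_eq; rewrite /GRing.scale /=; ring.
Qed.

Lemma grad_sqdist a z x : grad (sqdist a z) x = (2 * a) *: (x - z).
Proof.
apply/rowP => i; rewrite !mxE.
have [_ ->] := sqdist_is_derive a z (basis_vec i) x.
by rewrite dot_basis !mxE.
Qed.

Lemma sqdist_Ck1 a z : Ck 1 (sqdist a z).
Proof.
have dB x : differentiable (fun y : 'rV[R]_n => y - z) x.
  by apply: differentiableB.
split=> [x|v].
  by apply: differentiableM => //; exact: differentiable_dot.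
have -> : 'D_v (sqdist a z) = fun x => 2 * a * dot v (x - z).
  by apply: funext => x; have [_ ->] := sqdist_is_derive a z v x.
move=> x; apply: differentiable_continuous.
by apply: differentiableM => //; exact: differentiable_dot.
Qed.

(** The sign [sg] covers touching from above ([sg = 1]) and from below
([sg = - 1]); the two orders of derivatives are read off the restrictions of
[U] to the lines parallel to the coordinate axes. *)
Lemma touch_above_grad_laplacian (sg : R) (U : 'rV[R]_n -> R)
    (x p : 'rV[R]_n) (s : R) :
  sg ^+ 2 = 1 -> smooth U ->
  (forall y, sg * U (x + y) <= sg * U x + dot y p + s / 2 * dot y y) ->
  grad U x = sg *: p /\ sg * laplacian U x <= n%:R * s.
Proof.
move=> sg2 smU Ule.
have [dU dDU] : (forall y, differentiable U y) /\
    (forall v y, differentiable ('D_v U) y).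
  by have [h1 h2] := smU 2%N; split=> // v; have [] := h2 v.
have H i : sg * grad U x 0 i = p 0 i /\
    sg * 'D_(basis_vec i) ('D_(basis_vec i) U) x <= s.
  pose e : 'rV[R]_n := basis_vec i.
  have line (f : 'rV[R]_n -> R) (t : R) : (forall y, differentiable f y) ->
      is_derive t 1 (fun t => sg * f (x + t *: e)) (sg * 'D_e f (x + t *: e)).
    move=> df; have /is_derive_line ? : is_derive (x + t *: e) e f ('D_e f (x + t *: e)).
      by apply/derivableP/diff_derivable.
    by apply: is_derive_eq; rewrite /GRing.scale /=; ring.
  have [|||g1 g2] := @touch_above_derivatives R (fun t => sg * U (x + t *: e))
    (fun t => sg * 'D_e U (x + t *: e)) (sg * 'D_e ('D_e U) x) (p 0 i) s.
  - by move=> t; exact: line.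
  - by have := line _ 0 (dDU e); rewrite scale0r addr0.
  - move=> t; rewrite scale0r addr0; apply: le_trans (Ule _) _.
    rewrite !(dotZl, dotZr) !dot_basis !mxE !eqxx /=; lra.
  by move: g1; rewrite scale0r addr0 mxE.
split.
  by apply/rowP => i; rewrite !mxE -(H i).1 mulrA -expr2 sg2 mul1r mxE.
rewrite /laplacian mulr_sumr.
apply: le_trans (ler_sum _ (fun i _ => (H i).2)) _.
by rewrite sumr_const card_ord mulr_natl.
Qed.
End dot_theory.

(** * Compactness *)

Lemma compact_cball (R : realType) (n : nat) (r : R) :
  compact [set x : 'rV[R]_n | `|x| <= r].
Proof.
apply: bounded_closed_compact.
  by exists r; split; [exact: num_real | move=> M rM x /= /le_trans; apply; exact: ltW].
apply: (@closed_comp _ _ (fun x : 'rV[R]_n => `|x|) [set y | y <= r]).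
  by move=> x _; exact: norm_continuous.
exact: closed_le.
Qed.

Lemma continuous_bounded_on (R : realType) (T : topologicalType)
    (A : set T) (f : T -> R) :
  compact A -> continuous f -> exists2 B, 0 <= B & forall z, A z -> `|f z| <= B.
Proof.
move=> cA cf; have [->|A0] := eqVneq A set0; first by exists 0.
have [||c _ cmax] := @compact_EVT_max _ _ (fun z => `|f z|) A _ cA.
- exact/set0P.
- apply: continuous_subspaceT => z.
  by apply: (@continuous_comp _ _ _ f Num.norm); [exact: cf | exact: norm_continuous].
by exists `|f c| => // z Az; apply: cmax; exact/mem_set.
Qed.

(** * Hamiltonians along their momentum direction *)

Section hamiltonian.
Variables (R : realType) (n : nat) (H : 'rV[R]_n -> 'rV[R]_n -> R).
Hypothesis smH : smooth_hamiltonian H.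
Let Hj (z : 'rV[R]_n * 'rV[R]_n) : R := H z.1 z.2.

Lemma differentiable_hamiltonian_slice p x : differentiable (H^~ p) x.
Proof.
have [_ /(_ 1%N)[dH _]] := smH.
by apply: (@differentiable_comp _ _ _ _ (fun x : 'rV[R]_n => (x, p)) Hj).
Qed.

Lemma grad_hamiltonian_slice p x i :
  grad (H^~ p) x 0 i = 'D_(basis_vec i, 0) Hj (x, p).
Proof.
rewrite mxE; apply: (congr1 (fun q : R -> R => lim (q @ 0^'))).
apply: funext => h /=.
by rewrite /Hj /= scaler0 add0r.
Qed.

Lemma hamiltonian_line_is_derive (y p : 'rV[R]_n) (t : R) :
  is_derive t 1 (fun s => H (y + s *: p) p) (dot (grad (H^~ p) (y + t *: p)) p).
Proof.
have dH := differentiable_hamiltonian_slice p (y + t *: p).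
apply/(is_derive_line (H^~ p)); rewrite dotC -derive_dot_grad //.
exact/derivableP/diff_derivable.
Qed.

Lemma bounded_grad_hamiltonian (r : R) : exists2 L : R, 0 <= L & forall x p : 'rV[R]_n,
  `|x| <= r -> `|p| <= r -> `|dot (grad (H^~ p) x) p| <= L.
Proof.
have cD i : continuous ('D_(basis_vec i, 0) Hj) by have [_ /(_ 1%N)[_]] := smH; apply.
have cA : compact ([set x : 'rV[R]_n | `|x| <= r] `*` [set p : 'rV[R]_n | `|p| <= r]).
  by apply: compact_setX; exact: compact_cball.
have /choice[B HB] : forall i : 'I_n, exists B : R, 0 <= B /\
    forall x p, `|x| <= r -> `|p| <= r -> `|grad (H^~ p) x 0 i| <= B.
  move=> i; have [B B0 HB] := continuous_bounded_on cA (cD i).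
  by exists B; split=> // x p xr pr; rewrite grad_hamiltonian_slice; apply: HB.
exists (\sum_i B i * `|r|).
  by apply: sumr_ge0 => i _; rewrite mulr_ge0 // (HB i).1.
move=> x p xr pr; apply: le_trans (ler_norm_sum _ _ _) _.
apply: ler_sum => i _; rewrite normrM ler_pM // ?(HB i).2 //.
apply: le_trans (coord_le_norm _ _) _; apply: le_trans pr _; exact: ler_norm.
Qed.

(** The Hamiltonian at [x] is almost at least the one at [y], up to an error
proportional to [d], although [p] is unrestricted: for large [p] the growth
condition, with [|H| < C] absorbed into its arbitrary constant, makes [H]
increase in the direction [p] as long as [|H| < C], and for the remaining [p]
the slope is bounded by compactness.  The compactness needs one of the points
in a fixed ball; which one depends on the sign in [one_sided_rate]. *)
Lemma hamiltonian_quasi_monotone (c w C : R) : 0 < C -> 0 < w -> growth_condition H c w ->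
  exists2 L : R, 0 <= L & forall (d : R) (x y p : 'rV[R]_n), 0 < d <= 1 ->
    `|x| <= 1 \/ `|y| <= 1 -> x = y + d *: p ->
    - C < H y p -> H x p < C -> H y p - H x p <= L * d.
Proof.
move=> C0 w0 growH.
have [K HK] := growH (w * C ^+ 2).
have [L L0 HL] := bounded_grad_hamiltonian (1 + `|K|).
exists L => // d x y p /andP[d0 d1] xy xE Hy Hx.
have d00 : 0 <= d by exact: ltW.
pose f t := H (y + t *: p) p.
have fd (t : R) : is_derive t 1 f (dot (grad (H^~ p) (y + t *: p)) p).
  exact: hamiltonian_line_is_derive.
have f0 : f 0 = H y p by rewrite /f scale0r addr0.
have f1 : f d = H x p by rewrite /f xE.
have [pK|Kp] := leP (enorm p) K.
  have Kp : `|p| <= `|K|.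
    by apply: le_trans (norm_le_enorm p) _; apply: le_trans pK _; exact: ler_norm.
  have [|t] := MVT_segment d00 (fun t _ => fd t).
    apply: derivable_within_continuous => t _; by have [] := fd t.
  rewrite in_itv /= => /andP[t0 td]; rewrite f0 f1 subr0 => E.
  rewrite -opprB E -mulNr ler_wpM2r //.
  apply: le_trans (ler_norm _) _; rewrite normrN; apply: HL; last first.
    by apply: le_trans Kp _; rewrite lerDr.
  case: xy => h1; last first.
    apply: le_trans (ler_normD _ _) _; apply: lerD => //.
    rewrite normrZ ger0_norm //; apply: le_trans Kp.
    by rewrite ler_piMl //; lra.
  have -> : y + t *: p = x - (d - t) *: p
    by rewrite xE scalerBl opprB addrA addrAC addrK.
  apply: le_trans (ler_normB _ _) _; apply: lerD => //.
  rewrite normrZ ger0_norm ?subr_ge0 //; apply: le_trans Kp.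
  by rewrite ler_piMl //; lra.
suff: H y p <= H x p by move=> h; rewrite (le_trans _ (mulr_ge0 L0 d00)) // subr_le0.
rewrite -f0 -f1; apply: (no_down_crossing fd _ C0 d00); rewrite ?f0 ?f1 //.
move=> t _ ftC; have := HK (y + t *: p) p Kp.
have h2 : w * `|H (y + t *: p) p| ^+ 2 <= w * C ^+ 2.
  rewrite ler_pM2l //.
  by apply: lerXn2r; rewrite ?nnegrE ?normr_ge0 //; exact: ltW.
have h3 : 0 <= 16 * n%:R * w * c ^+ 2 * enorm p ^+ 2.
  do 2!(apply: mulr_ge0; last exact: sqr_ge0).
  by rewrite !mulr_ge0 ?ler0n // ltW.
lra.
Qed.
End hamiltonian.

(** * Doubling of variables on the torus *)

(** Subtracting the integer parts of the coordinates; the same translation [k]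
serves all periodic functions at once, which lets two variables be moved
together in the doubling argument. *)
Lemma torus_translate (R : realType) (n : nat) (x : 'rV[R]_n) :
  exists2 k : 'rV[R]_n, `|x + k| <= 1 &
    forall f, torus_fun f -> forall y, f (y + k) = f y.
Proof.
pose m i := - Num.floor (x 0 i).
exists (\sum_(i < n) basis_vec i *~ m i).
  change (mx_norm (x + \sum_(i < n) basis_vec i *~ m i) <= 1).
  rewrite mx_normrE; apply: bigmax_le => // -[i j] _ /=; rewrite {i}ord1 mxE.
  have -> : (\sum_(i < n) basis_vec i *~ m i : 'rV[R]_n) 0 j = (m j)%:~R.
    rewrite summxE (bigD1 j) //= big1 => [|i ij].
      by rewrite -scaler_int !mxE !eqxx mulr1 addr0.
    by rewrite -scaler_int !mxE eqxx eq_sym (negbTE ij) mulr0.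
  have := floor_itv (x 0 j); rewrite intrD1 => /andP[h1 h2].
  by rewrite ger0_norm /m mulrNz; lra.
move=> f tf; elim/big_rec: _ => [|i k _ IH] y; first by rewrite addr0.
rewrite addrA addrAC; have per := tf i.
suff E z : f (z + basis_vec i *~ m i) = f z by rewrite E IH.
case: (m i) => j; first exact: periodicn per _ _.
by rewrite NegzE mulrNz -(periodicn per j.+1 (z - _)) subrK.
Qed.

Lemma torus_bounded (R : realType) (n : nat) (f : 'rV[R]_n -> R) :
  torus_fun f -> continuous f -> exists2 B, 0 <= B & forall x, `|f x| <= B.
Proof.
move=> tf cf.
have [B B0 HB] := continuous_bounded_on (@compact_cball R n 1) cf.
exists B => // x; have [k xk fk] := torus_translate x.
by rewrite -(fk f tf x); exact: HB.
Qed.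

(** The function is invariant when [x] and [y] are translated together, so [x]
may be taken in the unit ball.  Then the penalty makes the value at a far [y]
smaller than the value at the origin, and compactness gives the maximum. *)
Lemma doubling_max (R : realType) (n : nat) (f g : bool -> 'rV[R]_n -> R) (a : R) :
  0 < a ->
  (forall i, torus_fun (f i) /\ continuous (f i)) ->
  (forall i, torus_fun (g i) /\ continuous (g i)) ->
  exists i x y, `|x| <= 1 /\ forall j x' y',
    f j x' - g j y' - sqdist a y' x' <= f i x - g i y - sqdist a y x.
Proof.
move=> a0 tf tg.
have /choice[B HB] : forall j, exists B : R, forall x, `|f j x| <= B /\ `|g j x| <= B.
  move=> j; have [B1 _ h1] := torus_bounded (tf j).1 (tf j).2.
  have [B2 _ h2] := torus_bounded (tg j).1 (tg j).2.
  by exists (Num.max B1 B2) => x; rewrite !le_max h1 h2 orbT.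
(* For [|x - y| >= r - 1 >= 1] the penalty is at least [a |x - y|], which is at
   least the largest possible variation, four times the bound, of [f j] and [g j]. *)
pose r := 1 + Num.max 1 (4 * Num.max (B true) (B false) / a).
pose A := [set x : 'rV[R]_n | `|x| <= 1] `*` [set y : 'rV[R]_n | `|y| <= r].
have cA : compact A by apply: compact_setX; exact: compact_cball.
pose F j (z : 'rV[R]_n * 'rV[R]_n) := f j z.1 - g j z.2 - sqdist a z.2 z.1.
have /choice[m Hm] : forall j, exists m : 'rV[R]_n * 'rV[R]_n,
    A m /\ forall z, A z -> F j z <= F j m.
  move=> j; have [||m mA Hm] := @compact_EVT_max _ _ (F j) A _ cA.
  - exists (0, 0); split; rewrite /= normr0 // /r; by rewrite addr_ge0 // le_max ler01.
  - apply: continuous_subspaceT => z; rewrite /F.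
    have cs : continuous (fun w : 'rV[R]_n => sqdist a 0 w).
      by move=> w; apply: differentiable_continuous;
        have [] := sqdist_Ck1 a (0 : 'rV[R]_n).
    have cB : (z' : 'rV[R]_n * 'rV[R]_n).1 - z'.2 @[z' --> z] --> z.1 - z.2.
      by apply: cvgB; [exact: cvg_fst | exact: cvg_snd].
    have -> : (fun z : 'rV[R]_n * 'rV[R]_n => f j z.1 - g j z.2 - sqdist a z.2 z.1) =
        (fun z => f j z.1 - g j z.2 - sqdist a 0 (z.1 - z.2)).
      by apply: funext => w; rewrite /sqdist subr0.
    apply: cvgB; last exact: (cvg_comp _ _ cB (cs _)).
    apply: cvgB.
      by apply: (cvg_comp fst (f j)); [exact: cvg_fst | exact: (tf j).2].
    by apply: (cvg_comp snd (g j)); [exact: cvg_snd | exact: (tg j).2].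
  by exists m; split=> [|z Az]; [exact: set_mem | apply: Hm; exact: mem_set].
have Fdiag j : F j (0, 0) <= F j (m j).
  apply: (Hm j).2; split; rewrite /= normr0 // /r; by rewrite addr_ge0 // le_max ler01.
have Fmax j z : F j z <= F j (m j).
  case: z => x y; have [k xk Hk] := torus_translate x.
  have -> : F j (x, y) = F j (x + k, y + k).
    by rewrite /F /= sqdist_translate (Hk _ (tf j).1) (Hk _ (tg j).1).
  move: (x + k) xk (y + k) => {}x x1 {}y.
  have [yr|ry] := leP `|y| r; first exact: (Hm j).2.
  apply: le_trans (Fdiag j); rewrite /F /= sqdist_same.
  have dr : Num.max 1 (4 * Num.max (B true) (B false) / a) <= `|x - y|.
    have := ler_normB x (x - y); rewrite subKr; move: ry; rewrite /r; lra.
  move: dr; rewrite ge_max ler_pdivrMr // => /andP[d1 d2].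
  have : a * `|x - y| <= sqdist a y x.
    rewrite ler_pM2l //; apply: le_trans (sqr_norm_le_dot _).
    by rewrite expr2 ler_peMl.
  have HBm : B j <= Num.max (B true) (B false).
    by case: j {Hm Fdiag}; rewrite le_max lexx ?orbT.
  have := (HB j x).1; have := (HB j y).2; have := (HB j 0).1; have := (HB j 0).2.
  rewrite !ler_norml; move: d2; set b := Num.max _ _ in HBm *; lra.
have [h|h] := leP (F true (m true)) (F false (m false)).
  exists false, (m false).1, (m false).2; split; first by have [[]] := Hm false.
  by case=> x' y'; [apply: le_trans (Fmax true (x', y')) h |
    exact: (Fmax false (x', y'))].
exists true, (m true).1, (m true).2; split; first by have [[]] := Hm true.
case=> x' y'; first exact: (Fmax true (x', y')).
apply: le_trans (Fmax false (x', y')) (ltW h).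
Qed.

(** * The rate of convergence *)

(** With [sg = 1] this is the upper bound of the theorem and uses that [u] is a
supersolution; with [sg = - 1] it is the lower bound and uses that [u] is a
subsolution.  In the second case the momentum at the maximum is [- p], and the
roles of [x] and [y] in [hamiltonian_quasi_monotone] are exchanged. *)
Lemma one_sided_rate (R : realType) (n : nat) (c : bool -> R)
    (H : bool -> 'rV[R]_n -> 'rV[R]_n -> R) (u : bool -> 'rV[R]_n -> R)
    (h sg : R) :
  (forall i, 0 < c i) -> (forall i, smooth_hamiltonian (H i)) ->
  (forall i, exists2 w, 0 < w & growth_condition (H i) (c i) w) ->
  (forall i, torus_fun (u i) /\ continuous (u i)) ->
  (forall i, viscosity_solution
     (fun x r p => c i * (r - u (~~ i) x) + H i x p - h) (u i)) ->
  sg = 1 \/ sg = - 1 ->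
  exists2 K : R, 0 <= K &
    forall (eps : R) (U : bool -> 'rV[R]_n -> R), 0 < eps < 1 ->
    (forall i, torus_fun (U i) /\ smooth (U i)) ->
    (forall i x, eps * U i x + c i * (U i x - U (~~ i) x) + H i x (grad (U i) x)
                 = eps ^+ 2 * laplacian (U i) x) ->
    forall i x, sg * (eps * U i x + h) <= K * eps.
Proof.
move=> c0 smH growH tu vu sg1.
have sg2 : sg ^+ 2 = 1 by case: sg1 => ->; rewrite ?sqrrN expr1n.
have /choice[B HB] : forall j, exists B : R, 0 <= B /\ forall x, `|u j x| <= B.
  by move=> j; have [B ? ?] := torus_bounded (tu j).1 (tu j).2; exists B.
pose b := B true + B false.
have bu j x : `|u j x| <= b.
  have := (HB true).1; have := (HB false).1; have := (HB j).2 x.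
  by rewrite /b; case: j; lra.
have b0 : 0 <= b by apply: addr_ge0; [exact: (HB true).1 | exact: (HB false).1].
(* [- C i] bounds [sg * H i y q] from below, and [C i] bounds [sg * H i x q] from
   above when the quantity to be estimated is positive. *)
pose C i := n%:R + `|h| + c i * (2 * b) + 1.
have C0 i : 0 < C i.
  rewrite ltr_wpDl // !addr_ge0 ?ler0n // mulr_ge0 ?(ltW (c0 i)) //; lra.
have /choice[L HL] : forall i, exists L : R, 0 <= L /\
   forall (d : R) (x y p : 'rV[R]_n), 0 < d <= 1 ->
    `|x| <= 1 \/ `|y| <= 1 -> x = y + d *: p ->
    - C i < H i y p -> H i x p < C i -> H i y p - H i x p <= L * d.
  move=> i; have [w w0 gw] := growH i.
  by have [L L0 HL] := hamiltonian_quasi_monotone (smH i) (C0 i) w0 gw; exists L.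
pose K := n%:R + (L true + L false) + 2 * b.
have LK i : L i <= L true + L false.
  by have := (HL true).1; have := (HL false).1; case: i; lra.
exists K.
  by rewrite !addr_ge0 ?ler0n ?(HL _).1 // mulr_ge0.
move=> eps U /andP[e0 e1] smU eqU.
pose a : R := (2 * eps)^-1.
have a0 : 0 < a by rewrite invr_gt0 mulr_gt0.
have cU i : continuous (U i) by exact: (smU i).2 0%N.
have scaled (f : bool -> 'rV[R]_n -> R) :
    (forall i, torus_fun (f i) /\ continuous (f i)) ->
    forall i, torus_fun (fun x => sg * f i x) /\ continuous (fun x => sg * f i x).
  move=> tf i; split=> [j x|x]; first by rewrite (tf i).1.
  exact: (@cvgM _ _ (nbhs x) _ (fun=> sg) (f i) sg (f i x) (cvg_cst _) ((tf i).2 x)).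
have [i [x [y [x1 Hmax]]]] := doubling_max a0
  (scaled U (fun i => conj (smU i).1 (cU i))) (scaled u tu).
pose p : 'rV[R]_n := eps^-1 *: (x - y).
have xE : x = y + eps *: p by rewrite scalerA divff ?gt_eqF // scale1r addrC subrK.
have twoa : 2 * a = eps^-1 by rewrite /a invfM mulrA divff ?mul1r // pnatr_eq0.
(* The viscous equation at [x]: the penalty has second derivative [1 / eps],
   which the factor [eps ^+ 2] turns into an error of order [eps]. *)
have [gU lU] : grad (U i) x = sg *: p /\ sg * laplacian (U i) x <= n%:R * (2 * a).
  apply: touch_above_grad_laplacian => //; first exact: (smU i).2.
  move=> v; have := Hmax i (x + v) y; rewrite sqdistD /p dotZr twoa.
  have -> : eps^-1 / 2 = a by rewrite /a invfM mulrC.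
  lra.
have viscous : sg * (eps * U i x + c i * (U i x - U (~~ i) x) + H i x (sg *: p))
    <= n%:R * eps.
  rewrite -gU eqU mulrCA; apply: le_trans (_ : eps ^+ 2 * (n%:R * (2 * a)) <= _).
    by rewrite ler_pM2l // exprn_gt0.
  by rewrite twoa expr2 mulrCA -mulrA divff ?mulr1 // gt_eqF.
(* At [y], [u i] is touched by the penalty with [x] frozen: from below if
   [sg = 1], from above if [sg = - 1]. *)
have inviscid : 0 <= sg * (c i * (u i y - u (~~ i) y) + H i y (sg *: p) - h).
  pose phi := sqdist (- sg * a) x.
  have gphi : grad phi y = sg *: p.
    rewrite grad_sqdist -(opprB x y) scalerN -scaleNr /p scalerA; congr (_ *: _).
    by rewrite -twoa; ring.
  have phi1 : Ck 1 phi by exact: sqdist_Ck1.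
  have phiE z : sg * phi z = - sqdist a z x.
    by rewrite /phi (sqdistC a z) /sqdist -[a in RHS]mul1r -sg2; ring.
  have touch z : sg * (u i y - phi y) <= sg * (u i z - phi z).
    by rewrite !mulrBr !phiE; have := Hmax i x z; lra.
  have near_touch : \forall z \near y, sg * (u i y - phi y) <= sg * (u i z - phi z).
    by near=> z; exact: touch.
  case: sg1 gphi near_touch => ->; rewrite ?scale1r ?scaleN1r => <- nt.
    rewrite mul1r; apply: ((vu i).2 phi y phi1).
    by apply: filterS nt => z; rewrite !mul1r.
  rewrite mulN1r oppr_ge0; apply: ((vu i).1 phi y phi1).
  by apply: filterS nt => z; rewrite !mulN1r lerN2.
set q := sg *: p in viscous inviscid *.
have nsg z : `|sg * z| = `|z|.
  by case: sg1 => ->; rewrite ?mul1r ?mulN1r ?normrN.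
have /andP[hge hle] : - `|h| <= sg * h <= `|h| by rewrite -ler_norml nsg.
have db : `|sg * (u i y - u (~~ i) y)| <= 2 * b.
  have := ler_normB (u i y) (u (~~ i) y); have := bu i y; have := bu (~~ i) y.
  by rewrite nsg; lra.
have [db1 db2] : - (c i * (2 * b)) <= c i * (sg * (u i y - u (~~ i) y)) /\
    c i * (sg * (u i y - u (~~ i) y)) <= c i * (2 * b).
  by move: db; rewrite ler_norml => /andP[? ?]; rewrite -mulrN !ler_pM2l.
(* Maximality against the other component at the same points [x], [y]. *)
have dD : c i * (sg * (u i y - u (~~ i) y)) <= c i * (sg * (U i x - U (~~ i) x)).
  by rewrite ler_pM2l //; have := Hmax (~~ i) x y; lra.
have neps : n%:R * eps <= n%:R :> R.
  by rewrite ler_piMr ?ler0n // ltW.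
have Leps : 0 <= (L true + L false) * eps.
  by rewrite mulr_ge0 ?(ltW e0) // addr_ge0 // (HL _).1.
have n0 : 0 <= n%:R * eps by rewrite mulr_ge0 ?ler0n // ltW.
(* Only a positive left-hand side needs a bound, and then [sg * eps * U i x] is
   bounded from below, as is needed to bound [H] at [x]. *)
have at_max : sg * (eps * U i x + h) <= (n%:R + (L true + L false)) * eps.
  have [pos|neg] := ltP 0 (sg * (eps * U i x + h)); last by rewrite mulrDl; lra.
  have HA : sg * H i x q < C i by rewrite /C; lra.
  have HBy : - C i < sg * H i y q by rewrite /C; lra.
  have HAB : sg * H i y q - sg * H i x q <= L i * eps.
    have e01 : 0 < eps <= 1 by rewrite e0 ltW.
    case: (sg1) => sgE; rewrite /q sgE ?scale1r ?scaleN1r ?mul1r ?mulN1r in HA HBy *.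
      by apply: (HL i).2; rewrite ?x1 //; left.
    rewrite opprK addrC; apply: (HL i).2 => //; first by right.
    - by rewrite xE scalerN addrK.
    - by lra.
    - by lra.
  have : L i * eps <= (L true + L false) * eps by rewrite ler_pM2r.
  lra.
(* From the maximum to an arbitrary point, by comparison with the diagonal. *)
move=> j x'.
have /(ler_wpM2l (ltW e0)) : sg * U j x' <= sg * U i x + 2 * b.
  have sq1 : 0 <= sqdist a y x by rewrite mulr_ge0 ?dot_ge0 // ltW.
  have := Hmax j x' x'; rewrite sqdist_same.
  have sb k z : `|sg * u k z| <= b by rewrite nsg.
  have := sb j x'; have := sb i y; rewrite !ler_norml => /andP[? ?] /andP[? ?]; lra.
rewrite /K; lra.
Unshelve. all: by end_near.
Qed.

Theorem theorem4p6 (R : realType) (n : nat) (hn : (2 <= n)%N)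
    (c1 c2 : R) (hc1 : 0 < c1) (hc2 : 0 < c2)
    (H1 H2 : 'rV[R]_n -> 'rV[R]_n -> R)
    (smH1 : smooth_hamiltonian H1) (smH2 : smooth_hamiltonian H2)
    (hgrowth : exists omega1 omega2 : R,
      [/\ 0 < omega1, 0 < omega2,
          growth_condition H1 c1 omega1 & growth_condition H2 c2 omega2])
    (u1 u2 : R -> 'rV[R]_n -> R)
    (hu : forall eps : R, 0 < eps ->
      regularized_solution c1 c2 H1 H2 eps (u1 eps) (u2 eps))
    (Hbar : R) (hHbar : effective_hamiltonian c1 c2 H1 H2 Hbar) :
  exists eps0 C : R, [/\ 0 < eps0, 0 < C &
    forall eps : R, 0 < eps < eps0 ->
      (sup_norm (fun x => (eps * u1 eps x + Hbar)%R) <= (C * eps)%:E)%E /\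
      (sup_norm (fun x => (eps * u2 eps x + Hbar)%R) <= (C * eps)%:E)%E].
Proof.
have [w1 [w2 [w10 w20 g1 g2]]] := hgrowth.
have [[v1 [v2 [tv1 tv2 vv1 vv2]]] _] := hHbar.
pose c i := if i then c1 else c2.
pose H i := if i then H1 else H2.
pose v i := if i then v1 else v2.
have rate (sg : R) : sg = 1 \/ sg = - 1 -> exists2 K : R, 0 <= K &
    forall (eps : R) i x, 0 < eps < 1 ->
      sg * (eps * (if i then u1 eps else u2 eps) x + Hbar) <= K * eps.
  move=> sg1; have [||||||K K0 HK] := @one_sided_rate R n c H v Hbar sg.
  - by case.
  - by case.
  - by case; [exists w1 | exists w2].
  - by case.
  - case; [move: vv1 | move: vv2]; congr viscosity_solution;
      apply: funext => x; apply: funext => r; apply: funext => p;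
      rewrite /c /v /H /=; ring.
  - exact: sg1.
  exists K => // eps i x e01; have /andP[e0 _] := e01.
  have [[tu1 su1] [tu2 su2] eq1 eq2] := hu eps e0.
  apply: (HK eps (fun i => if i then u1 eps else u2 eps) e01); first by case.
  by case=> y; rewrite /c /H /=; [rewrite -eq1 | rewrite -eq2]; ring.
have [K K0 HK] := rate 1 (or_introl erefl).
have [K' K'0 HK'] := rate (- 1) (or_intror erefl).
exists 1, (K + K' + 1); split; [exact: ltr01 | by rewrite ltr_wpDl ?addr_ge0 |].
move=> eps e01; have /andP[e0 _] := e01.
have bound i : (sup_norm (fun x => eps * (if i then u1 eps else u2 eps) x + Hbar)%R
    <= ((K + K' + 1) * eps)%:E)%E.
  apply: ge_ereal_sup => _ [x _ <-]; rewrite lee_fin ler_norml.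
  have := HK eps i x e01; have := HK' eps i x e01.
  have := mulr_ge0 K0 (ltW e0); have := mulr_ge0 K'0 (ltW e0).
  by move=> *; apply/andP; split; lra.
by split; [exact: (bound true) | exact: (bound false)].
Qed.
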